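(* Let $q$ be a prime and let $\mathcal{S}$ be a stabilizer code with parameters $[[n,k,d]]_q$. Then $\mathcal{S}$ can be transformed into an $[[n,k,d']]_{\mathbb{Z}}$ stabilizer code with $d'=d^*\geq d$.
   Context: For prime $q$, qudit Paulis are generated by $X|j\rangle=|j+1 \bmod q\rangle$, $Z|j\rangle=e^{2\pi ij/q}|j\rangle$. Over $\mathbb{Z}$ (infinite discrete local-dimension, basis $|j\rangle$, $j\in\mathbb{Z}$), Paulis are generated by $X|j\rangle=|j+1\rangle$, $X^{-1}|j\rangle=|j-1\rangle$, $Z|j\rangle=\omega_\infty^j|j\rangle$ with $\omega_\infty=e^{2\pi i/\sqrt2}$. An $n$-register Pauli $\bigotimes_t X^{a_t}Z^{b_t}$ has integer representation $\phi_\infty=(\vec a|\vec b)\in\mathbb{Z}^{2n}$; the symplectic product is $(\vec a|\vec b)\odot(\vec a'|\vec b')=\vec a\cdot\vec b'-\vec a'\cdot\vec b$. A stabilizer code $[[n,k,d]]$ has $n$ physical registers, $k$ logical registers, and distance $d$ equal to the minimum weight (number of non-identity factors) of a Pauli commuting with all stabilizers but not in the stabilizer group (over $\mathbb{Z}$, commuting means integer symplectic product exactly $0$). A local-dimension-invariant (LDI) form of $\mathcal{S}$ is a set of integer generator vectors congruent modulo $q$ to generators of $\mathcal{S}$ with pairwise integer symplectic products exactly $0$; the $\mathbb{Z}$ code is the one generated by this LDI form. An unavoidable error is a Pauli (not in the stabilizer group) whose integer symplectic product with each LDI generator is exactly $0$; $d^*$ is the minimal weight of an unavoidable error. *)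

(* Defs.v *)
(* Pauli vectors on n registers are row vectors (a|b) of
   length n + n; the X-part is lsubmx, the Z-part is rsubmx. *)
From HB Require Import structures.
From mathcomp Require Import all_boot all_order all_algebra.
Set Implicit Arguments. Unset Strict Implicit. Unset Printing Implicit Defensive.
Import Order.TTheory GRing.Theory Num.Theory.
Local Open Scope ring_scope.

Section Pauli.
Variables (R : comNzRingType) (n : nat).

Definition symp (u v : 'rV[R]_(n + n)) : R :=
  \sum_(i < n) (lsubmx u 0 i * rsubmx v 0 i - lsubmx v 0 i * rsubmx u 0 i).

Definition wt (u : 'rV[R]_(n + n)) : nat :=
  #|[set i : 'I_n | (lsubmx u 0 i != 0) || (rsubmx u 0 i != 0)]|.

Definition isotropic m (G : 'M[R]_(m, n + n)) : Prop :=
  forall i j, symp (row i G) (row j G) = 0.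

Definition min_weight (P : 'rV[R]_(n + n) -> Prop) (d : nat) : Prop :=
  (exists v, P v /\ wt v = d) /\ (forall v, P v -> (d <= wt v)%N).
End Pauli.

Section Qudit.
Variables (q n : nat).

(* logical error: commutes (mod q) with every stabilizer (every element of the
   row space of G) but is not in the stabilizer group *)
Definition logical_q m (G : 'M['F_q]_(m, n + n)) (v : 'rV['F_q]_(n + n)) : Prop :=
  (forall s : 'rV['F_q]_(n + n), (s <= G)%MS -> symp s v = 0) /\ ~~ (v <= G)%MS.

Definition stab_code_q (k d : nat) (G : 'M['F_q]_(n - k, n + n)) : Prop :=
  [/\ (k <= n)%N, isotropic G, row_free G & min_weight (logical_q G) d].

Definition LDI_form m (G : 'M['F_q]_(m, n + n)) (L : 'M[int]_(m, n + n)) : Prop :=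
  map_mx (fun z : int => z%:~R) L = G /\ isotropic L.
End Qudit.

Section Integer.
Variables (n m : nat) (L : 'M[int]_(m, n + n)).

(* v is in the stabilizer group generated by the rows of L (phases ignored) *)
Definition in_zspan (v : 'rV[int]_(n + n)) : Prop :=
  exists c : 'rV[int]_m, v = c *m L.

Definition unavoidable (v : 'rV[int]_(n + n)) : Prop :=
  (forall i, symp (row i L) v = 0) /\ ~ in_zspan v.

Definition dstar (d : nat) : Prop := min_weight (@unavoidable) d.

Definition logical_Z (v : 'rV[int]_(n + n)) : Prop :=
  (forall s, in_zspan s -> symp s v = 0) /\ ~ in_zspan v.

Definition stab_code_Z (k d : nat) : Prop :=
  [/\ isotropic L, \rank (map_mx (fun z : int => (z%:~R : rat)) L) = (n - k)%N
    & min_weight logical_Z d].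
End Integer.

Arguments stab_code_q {q n} k d G.
Arguments stab_code_Z {n m} L k d.
Arguments dstar {n m} L d.
Arguments LDI_form {q n m} G L.

(* Main.v *)
(* Write J for the symplectic matrix and r = n - k.  Integral isotropic lifts of
   G are plentiful: one lift exists because the row space of G misses some
   coordinate Lagrangian, which makes the defect of an arbitrary lift correctable
   without division; further lifts come from transvections x |-> x + q t <x,u> u.
   For a set A of registers consider the rank over Q of the columns of L lying
   over A.  As long as it is less than 2|A| <= r, a suitable transvection raises
   it while lowering none of the others, so a lift L exists for which it is 2|A|
   whenever 2|A| <= r.  No nonzero integer vector of weight w with 2w <= r then
   commutes with L, not even one that is a stabilizer modulo q.  The quantum
   Singleton bound 2(d - 1) <= r turns this into d <= d*.  Finally, d* is attained
   since a logical operator modulo q lifts to an integer vector commuting with L. *)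
Require Import Defs.
From mathcomp Require Import all_boot all_order all_algebra.
From mathcomp Require Import ring zify.
From Stdlib Require Classical_Prop.
Set Implicit Arguments. Unset Strict Implicit. Unset Printing Implicit Defensive.
Import Order.TTheory GRing.Theory Num.Theory.
Local Open Scope ring_scope.

(** * The symplectic form *)

Section SymplecticForm.
Variables (R : comNzRingType) (n : nat).

Definition sympmx : 'M[R]_(n + n) := block_mx 0 1%:M (- 1%:M) 0.

Lemma tr_sympmx : sympmx^T = - sympmx.
Proof.
by rewrite /sympmx tr_block_mx opp_block_mx !trmx0 linearN /= trmx1 !oppr0 opprK.
Qed.

Lemma sympmx_sqr : sympmx *m sympmx = - 1%:M.
Proof.
rewrite /sympmx mulmx_block !mulmx0 !mul0mx !mul1mx !mulmx1 addr0 !add0r addr0.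
by rewrite [1%:M in RHS]scalar_mx_block opp_block_mx !oppr0.
Qed.

Lemma symp_mx (u v : 'rV[R]_(n + n)) : symp u v = (u *m sympmx *m v^T) 0 0.
Proof.
have ->: u *m sympmx *m v^T =
    lsubmx u *m (rsubmx v)^T - rsubmx u *m (lsubmx v)^T.
  rewrite -{1}[u]hsubmxK -{1}[v]hsubmxK tr_row_mx mul_row_block mul_row_col.
  by rewrite !mulmx0 mulmx1 mulmxN mulmx1 add0r addr0 mulNmx addrC.
rewrite /symp big_split /= sumrN !mxE; congr (_ - _).
  by apply: eq_bigr => i _; rewrite !mxE.
by apply: eq_bigr => i _; rewrite !mxE mulrC.
Qed.

Lemma symp_rows m m' (G : 'M[R]_(m, n + n)) (H : 'M[R]_(m', n + n)) i j :
  symp (row i G) (row j H) = (G *m sympmx *m H^T) i j.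
Proof.
rewrite symp_mx tr_row -row_mul [LHS]mxE [RHS]mxE.
by apply: eq_bigr => k _; rewrite [in LHS]mxE [col _ _ _ _]mxE.
Qed.

Lemma symp_rowsP m (G : 'M[R]_(m, n + n)) (v : 'rV[R]_(n + n)) :
  (forall i, symp (row i G) v = 0) <-> G *m sympmx *m v^T = 0.
Proof.
have e i : symp (row i G) v = (G *m sympmx *m v^T) i 0.
  by rewrite -symp_rows row_id.
split=> [h | h i]; last by rewrite e h mxE.
by apply/colP=> i; rewrite -e h mxE.
Qed.

Lemma isotropicP m (G : 'M[R]_(m, n + n)) :
  isotropic G <-> G *m sympmx *m G^T = 0.
Proof.
split=> [h | h i j]; last by rewrite symp_rows h mxE.
by apply/matrixP=> i j; rewrite -symp_rows h mxE.
Qed.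

Lemma tr_symp_form m m' (G : 'M[R]_(m, n + n)) (H : 'M[R]_(m', n + n)) :
  (G *m sympmx *m H^T)^T = - (H *m sympmx *m G^T).
Proof. by rewrite !trmx_mul trmxK tr_sympmx mulNmx mulmxN mulmxA. Qed.

Lemma symp_alt (u : 'rV[R]_(n + n)) : u *m sympmx *m u^T = 0.
Proof.
apply/matrixP=> i j; rewrite !ord1 -symp_mx mxE /symp.
by apply: big1 => k _; rewrite subrr.
Qed.

(** The columns span a coordinate Lagrangian, with one unit vector per register. *)
Definition pickmx (f : 'I_n -> bool) : 'M[R]_(n + n, n) :=
  col_mx (diag_mx (\row_j (f j)%:R)) (diag_mx (\row_j (~~ f j)%:R)).

Lemma pickmx_isotropic f : (pickmx f)^T *m sympmx *m pickmx f = 0.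
Proof.
rewrite /pickmx tr_col_mx !tr_diag_mx mul_row_block !mulmx0 mulmxN !mulmx1.
by rewrite add0r addr0 mul_row_col mulNmx diag_mxC addNr.
Qed.

Lemma pickmxE m f (G : 'M[R]_(m, n + n)) i j :
  (G *m pickmx f) i j = if f j then lsubmx G i j else rsubmx G i j.
Proof.
rewrite -{1}[G]hsubmxK mul_row_col !mul_mx_diag !mxE.
by case: (f j); rewrite ?mulr1 ?mulr0 ?addr0 ?add0r.
Qed.

(** Restriction to [A] is encoded as a matrix so that supports can be handled through ranks, row
    spaces and ring morphisms. *)
Definition restrmx (A : {set 'I_n}) : 'M[R]_(n + n) :=
  let D := diag_mx (\row_j (j \in A)%:R) in block_mx D 0 0 D.

Lemma tr_restrmx A : (restrmx A)^T = restrmx A.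
Proof. by rewrite /restrmx tr_block_mx !tr_diag_mx !trmx0. Qed.

Lemma restrmx_symp A : restrmx A *m sympmx = sympmx *m restrmx A.
Proof.
rewrite /restrmx /sympmx !mulmx_block !mulmx0 !mul0mx !mulmxN !mulNmx.
by rewrite !mulmx1 !mul1mx !addr0 !add0r.
Qed.

Lemma restrmxE m (v : 'M[R]_(m, n + n)) A :
  v *m restrmx A = row_mx (\matrix_(i, j) (lsubmx v i j *+ (j \in A)))
                          (\matrix_(i, j) (rsubmx v i j *+ (j \in A))).
Proof.
rewrite -{1}[v]hsubmxK mul_row_block !mulmx0 addr0 add0r !mul_mx_diag.
by congr row_mx; apply/matrixP=> i j; rewrite !mxE mulr_natr.
Qed.

Lemma restrmxC A : restrmx A + restrmx (~: A) = 1%:M.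
Proof.
rewrite -[LHS]mul1mx mulmxDr !restrmxE add_row_mx -[RHS]hsubmxK.
congr row_mx; apply/matrixP=> i j;
by rewrite !mxE -mulrnDr inE; case: (j \in A).
Qed.

Lemma restrmx_id m (v : 'M[R]_(m, n + n)) A :
  v *m restrmx A *m restrmx A = v *m restrmx A.
Proof.
rewrite !restrmxE; congr row_mx; apply/matrixP=> i j;
by rewrite ?row_mxKl ?row_mxKr !mxE; case: (j \in A).
Qed.

Definition supp (u : 'rV[R]_(n + n)) : {set 'I_n} :=
  [set i : 'I_n | (lsubmx u 0 i != 0) || (rsubmx u 0 i != 0)].

Lemma restrmx_supp (v : 'rV[R]_(n + n)) : v *m restrmx (supp v) = v.
Proof.
rewrite restrmxE -[RHS]hsubmxK; congr row_mx; apply/matrixP=> i j;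
rewrite ord1 !mxE inE !mxE; case: (eqVneq (v 0 (lshift n j)) 0) => [hl | _];
by case: (eqVneq (v 0 (rshift n j)) 0) => [hr | _]; rewrite ?hl ?hr ?mul0rn.
Qed.

Lemma restrmx_eq0 (v : 'rV[R]_(n + n)) A :
  v *m restrmx A = 0 -> supp v \subset ~: A.
Proof.
rewrite restrmxE -[RHS]row_mx0 => /eq_row_mx [/rowP hl /rowP hr].
apply/subsetP=> i; rewrite !inE; apply: contraL => iA.
have := hl i; have := hr i; rewrite !mxE iA !mulr1n => -> ->.
by rewrite eqxx.
Qed.

End SymplecticForm.

Arguments sympmx {R n}.

Lemma map_sympmx (R S : comNzRingType) (f : {rmorphism R -> S}) n :
  map_mx f (@sympmx R n) = sympmx.
Proof. by rewrite /sympmx map_block_mx map_mxN !map_mx1 !map_mx0. Qed.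

Lemma map_restrmx (R S : comNzRingType) (f : {rmorphism R -> S}) n (A : {set 'I_n}) :
  map_mx f (restrmx R A) = restrmx S A.
Proof.
rewrite /restrmx map_block_mx !map_diag_mx !map_mx0.
have -> // : map_mx f (\row_j (j \in A)%:R) = \row_j (j \in A)%:R.
by apply/rowP=> j; rewrite !mxE rmorph_nat.
Qed.

Lemma sympmx_unit (R : comUnitRingType) n : @sympmx R n \in unitmx.
Proof.
have : @sympmx R n *m - sympmx = 1%:M by rewrite mulmxN sympmx_sqr opprK.
by case/mulmx1_unit.
Qed.

Lemma mxrank_restrmx (F : fieldType) n (A : {set 'I_n}) :
  (\rank (restrmx F A) <= #|A|.*2)%N.
Proof.
rewrite /restrmx rank_diag_block_mx -addnn.
suff h : (\rank (diag_mx (\row_j (j \in A)%:R : 'rV[F]_n)) <= #|A|)%N.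
  by apply: leq_add.
pose B : 'M[F]_(#|A|, n) := \matrix_(i < #|A|) delta_mx 0 (enum_val i).
apply: leq_trans (rank_leq_row B); apply: mxrankS.
apply/row_subP=> i; have [iA | iA] := boolP (i \in A).
  rewrite (_ : row i _ = row (enum_rank_in iA i) B) ?row_sub // row_diag_mx rowK.
  by rewrite mxE iA scale1r enum_rankK_in.
by rewrite row_diag_mx mxE (negbTE iA) scale0r sub0mx.
Qed.

(** * Lifting from F_q to the integers *)

(* If both choices at register [i] failed, the two witnesses would agree to be
   zero on one coordinate of every register other than [i], and at [i] one would
   be a pure X and the other a pure Z, so they could not commute. *)
Lemma isotropic_transversal (F : finFieldType) n (P : pred 'rV[F]_(n + n)) :
  {in P &, forall u v, symp u v = 0} ->
  exists f : 'I_n -> bool, {in P, forall u,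
    (forall j, (if f j then lsubmx u 0 j else rsubmx u 0 j) = 0) -> u = 0}.
Proof.
move=> Piso.
pose coord (f : 'I_n -> bool) (u : 'rV[F]_(n + n)) j :=
  if f j then lsubmx u 0 j else rsubmx u 0 j.
(* Induct on [i]: [low i f u] interpolates between [u = 0] at [i = 0] and vanishing on the whole
   transversal at [i = n]. *)
pose low i (f : 'I_n -> bool) (u : 'rV[F]_(n + n)) := [forall j : 'I_n,
  if (j < i)%N then coord f u j == 0
  else (lsubmx u 0 j == 0) && (rsubmx u 0 j == 0)].
suff /(_ n (leqnn n)) [f hf] :
    forall i, (i <= n)%N -> exists f, {in P, forall u, low i f u -> u = 0}.
  exists f => u Pu h; apply: hf => //; apply/forallP=> j.
  by rewrite ltn_ord; apply/eqP; apply: h.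
elim=> [_ | i IH lt_in].
  exists xpredT => u _ /forallP h; rewrite -[u]hsubmxK -[RHS]row_mx0.
  by congr row_mx; apply/rowP=> j; case/andP: (h j) => /eqP hl /eqP hr;
     rewrite [RHS]mxE.
have [f hf] := IH (ltnW lt_in); pose i0 := Ordinal lt_in.
pose fb b j := if j == i0 then b else f j.
have lowW b u : low i.+1 (fb b) u ->
    coord (fb (~~ b)) u i0 = 0 -> low i f u.
  move=> /forallP h h0; apply/forallP=> j.
  have := h j; rewrite /coord /fb ltnS leq_eqVlt.
  have [-> | nji] := eqVneq j i0; last first.
    by rewrite -[_ == i :> nat]/(j == i0) (negbTE nji).
  rewrite eqxx ltnn /=; move: h0; rewrite /coord /fb eqxx.
  by case: b {h} => /= -> ->; rewrite eqxx.
have alt b : {in P, forall u, low i.+1 (fb b) u -> u = 0} \/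
   exists u, [/\ u \in P, low i.+1 (fb b) u & coord (fb (~~ b)) u i0 != 0].
  have [/existsP [u /and3P [Pu lu nu]] | none] := boolP
    [exists u, [&& u \in P, low i.+1 (fb b) u & coord (fb (~~ b)) u i0 != 0]].
    by right; exists u.
  left=> u Pu lu; apply: hf => //; apply: lowW (lu) _; apply/eqP.
  by move/existsPn/(_ u): none; rewrite Pu lu negbK.
have [h | [u [Pu /forallP lu nu]]] := alt true; first by exists (fb true).
have [h | [v [Pv /forallP lv nv]]] := alt false; first by exists (fb false).
have := Piso u v Pu Pv; rewrite /symp (bigD1 i0) //= big1 => [/eqP | j nj].
  move: (lu i0) nu nv; rewrite /coord /fb ltnSn eqxx /= => /eqP -> nu nv.
  by rewrite mul0r sub0r addr0 oppr_eq0 mulf_eq0 (negbTE nu) (negbTE nv).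
have := lu j; have := lv j; rewrite /coord /fb (negbTE nj).
case: ifP => _; last first.
  by move=> /andP [/eqP -> /eqP ->] /andP [/eqP -> /eqP ->]; rewrite !mul0r subrr.
by case: (f j) => /eqP -> /eqP ->; rewrite !(mul0r, mulr0) subrr.
Qed.

Section Reduction.
Variables (q : nat) (q_prime : prime q).

Lemma intr_Fq_eq0 (z : int) : (z%:~R == 0 :> 'F_q) = (q %| z)%Z.
Proof. exact/esym/dvdz_pcharf/pchar_Fp. Qed.

Local Notation red := (map_mx (intr : int -> 'F_q)).

Lemma red_lift m n (M : 'M['F_q]_(m, n)) : exists L, red L = M.
Proof.
exists (map_mx (fun x : 'F_q => (x : nat)%:Z) M); apply/matrixP=> i j.
by rewrite !mxE -[RHS]natr_Zp.
Qed.

Lemma redZ_qmul m n (M : 'M_(m, n)) : red (q%:Z *: M) = 0.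
Proof.
apply/matrixP=> i j; rewrite !mxE; apply/eqP.
by rewrite intr_Fq_eq0 dvdz_mulr.
Qed.

Lemma red_det m (K : 'M_m) : red K = 1%:M -> (\det K)%:~R = 1 :> 'F_q.
Proof. by move=> h; rewrite -det_map_mx h det1. Qed.

Lemma red_adj m (K : 'M_m) : red K = 1%:M -> red (\adj K) = 1%:M.
Proof. by move=> h; rewrite map_mx_adj h -[LHS]mulmx1 mul_adj_mx det1. Qed.

(** [L *m R] may fail to be invertible over the integers, but its determinant is 1 modulo [q], hence
    nonzero, and its adjugate can replace an inverse. *)
Lemma red_rinv m n (L : 'M_(m, n)) :
  row_free (red L) -> exists R, red (L *m R) = 1%:M.
Proof.
case/row_freeP=> B LB; have [R RB] := red_lift B.
by exists R; rewrite map_mxM RB.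
Qed.

Lemma row_free_rat m n (L : 'M_(m, n)) :
  row_free (red L) -> row_free (map_mx (intr : int -> rat) L).
Proof.
case/red_rinv=> R /red_det dR.
have U : map_mx (intr : int -> rat) L *m map_mx intr R \in unitmx.
  rewrite -map_mxM unitmxE det_map_mx unitfE intr_eq0.
  by apply/eqP=> d0; move/eqP: dR; rewrite d0 eq_sym oner_eq0.
apply/row_freeP; exists (map_mx intr R *m invmx (map_mx intr L *m map_mx intr R)).
by rewrite mulmxA mulmxV.
Qed.

(* Correct an arbitrary lift [v0] by the multiple [R adj(L R) (L v0)] of [q],
   after scaling by [det (L R)], which is [1] modulo [q]. *)
Lemma kernel_lift r n (L : 'M_(r, n)) (w : 'cV['F_q]_n) :
  row_free (red L) -> red L *m w = 0 -> exists v, red v = w /\ L *m v = 0.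
Proof.
case/red_rinv=> R LR Lw; have [v0 v0w] := red_lift w.
exists (\det (L *m R) *: v0 - R *m (\adj (L *m R) *m (L *m v0))); split.
  rewrite map_mxB map_mxZ /= red_det // scale1r !map_mxM v0w Lw.
  by rewrite !mulmx0 subr0.
rewrite mulmxBr -scalemxAr !mulmxA mul_mx_adj.
by rewrite mul_scalar_mx -!scalemxAl subrr.
Qed.

(** [N] is the strictly lower triangle of [D / q], so nothing is halved and [q = 2] is covered. The
    diagonal of [D] vanishes because its double does. *)
Lemma skew_divisible_split r (D : 'M[int]_r) :
  D^T = - D -> red D = 0 -> exists N, D = q%:Z *: (N - N^T).
Proof.
move=> Dskew D0.
have skew i j : D j i = - D i j by move/matrixP/(_ i j): Dskew; rewrite !mxE.
have alt i : D i i = 0.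
  by apply/eqP; have /eqP := skew i i; rewrite -addr_eq0 -mulr2n mulrn_eq0.
have Dq i j : ((D i j %/ q)%Z * q = D i j)%R.
  apply: divzK; rewrite -intr_Fq_eq0; move/matrixP/(_ i j): D0.
  by rewrite !mxE => ->.
exists (\matrix_(i, j) if (j < i)%N then (D i j %/ q)%Z else 0).
apply/matrixP=> i j; rewrite !mxE; case: ltngtP => [lt | lt | /ord_inj ->].
- by rewrite subr0 mulrC Dq.
- by rewrite sub0r mulrN mulrC Dq skew.
- by rewrite subrr mulr0 alt.
Qed.

(* [T] spans an isotropic space on which the commutation matrix with [G] is the
   identity; it can be taken integral and exactly isotropic because it consists of
   combinations of the vectors of a coordinate Lagrangian. *)
Lemma isotropic_dual_lift r n (G : 'M['F_q]_(r, n + n)) :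
  row_free G -> isotropic G ->
  exists T : 'M[int]_(r, n + n),
    T *m sympmx *m T^T = 0 /\ G *m sympmx *m (red T)^T = 1%:M.
Proof.
move=> Gfree /isotropicP Giso.
have [u v Gu Gv | f hf] := @isotropic_transversal _ n (fun u => u <= G)%MS.
  have [/submxP [a ->] /submxP [b ->]] := (Gu, Gv).
  by rewrite symp_mx trmx_mul !mulmxA -2!(mulmxA a) Giso mulmx0 mul0mx mxE.
have : row_free (G *m pickmx _ f).
  rewrite -kermx_eq0; apply/rowV0P=> c /sub_kermxP; rewrite mulmxA => h.
  apply: (row_free_inj Gfree); rewrite mul0mx; apply: hf => [|j].
    exact: submxMl.
  by rewrite -pickmxE h mxE.
case/row_freeP=> S GS; have [S0 S0S] := red_lift S^T.
(* The trailing [sympmx] cancels the one in the form up to sign, so the commutation matrix with [G]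
   becomes [G *m pickmx _ f *m S], the identity. *)
exists (S0 *m (pickmx _ f)^T *m sympmx).
have TT : (S0 *m (pickmx _ f)^T *m sympmx)^T = - (sympmx *m pickmx _ f *m S0^T).
  by rewrite !trmx_mul trmxK tr_sympmx mulNmx mulmxA.
split.
  rewrite TT mulmxN -!mulmxA (mulmxA sympmx sympmx) sympmx_sqr.
  rewrite mulNmx mul1mx !mulmxN opprK (mulmxA sympmx) (mulmxA _^T).
  by rewrite (mulmxA _^T) pickmx_isotropic mul0mx mulmx0.
rewrite map_trmx TT map_mxN !map_mxM -map_trmx S0S trmxK map_sympmx.
have -> : red (pickmx _ f) = pickmx _ f.
  rewrite /pickmx map_col_mx !map_diag_mx; congr col_mx; congr diag_mx;
  by apply/rowP=> j; rewrite !mxE; case: (f j).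
rewrite mulmxN !mulmxA -(mulmxA G) sympmx_sqr mulmxN !mulNmx mulmx1 opprK.
exact: GS.
Qed.

(* Replacing an arbitrary lift [L0] by [L1 = adj(K) L0] makes its commutation matrix
   with [T] the scalar [d = det K]; adding [q N T] to [d L1] then changes the
   commutation matrix of [d L1] with itself by exactly [q d^2 (N^T - N)]. *)
Lemma isotropic_lift r n (G : 'M['F_q]_(r, n + n)) :
  row_free G -> isotropic G -> exists L, LDI_form G L.
Proof.
move=> Gfree Giso.
have [T [Tiso GT]] := isotropic_dual_lift Gfree Giso.
have [L0 L0G] := red_lift G.
pose K := L0 *m sympmx *m T^T; pose d := \det K; pose L1 := \adj K *m L0.
have redK : red K = 1%:M by rewrite !map_mxM -map_trmx map_sympmx L0G.
have redL1 : red L1 = G by rewrite map_mxM red_adj // mul1mx.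
have L1T : L1 *m sympmx *m T^T = d%:M.
  by rewrite /L1 -!mulmxA (mulmxA L0) mul_adj_mx.
have TL1 : T *m sympmx *m L1^T = - d%:M.
  by apply: trmx_inj; rewrite tr_symp_form L1T linearN /= tr_scalar_mx.
have d1 : d%:~R = 1 :> 'F_q by apply: red_det.
clearbody d L1; have [||N DN] := @skew_divisible_split _ (L1 *m sympmx *m L1^T).
- by rewrite tr_symp_form.
- by rewrite !map_mxM -map_trmx map_sympmx redL1; apply/isotropicP.
exists (d *: L1 + q%:Z *: (N *m T)); split.
  rewrite map_mxD redZ_qmul addr0 map_mxZ /= d1 scale1r; exact: redL1.
apply/isotropicP; rewrite linearD /= !linearZ /= trmx_mul.
rewrite !(mulmxDl, mulmxDr) -!scalemxAl -!scalemxAr.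
have -> : N *m T *m sympmx *m L1^T = - (d *: N).
  by rewrite -!mulmxA (mulmxA T) TL1 mulmxN mul_mx_scalar.
rewrite [L1 *m sympmx *m (_ *m _)]mulmxA L1T mul_scalar_mx.
have -> : N *m T *m sympmx *m (T^T *m N^T) = 0.
  by rewrite !mulmxA -2!(mulmxA N) Tiso mulmx0 mul0mx.
rewrite DN !scaler0 addr0; apply/matrixP=> i j; rewrite !mxE.
ring.
Qed.
End Reduction.

(** * Raising ranks by transvections *)

(** The left kernel shrinks strictly. If [x] kills the sum, then [(x c) u] lies in the row space of
    [M], so [x c = 0] and [x M = 0]; and some [x] killing [M] does not kill [c], as [c] is outside
    the column space. *)
Lemma mxrank_add_rank1 (F : fieldType) m n (M : 'M[F]_(m, n))
    (c : 'cV_m) (u : 'rV_n) :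
  ~~ (u <= M)%MS -> ~~ (c^T <= M^T)%MS -> (\rank M < \rank (M + c *m u)%R)%N.
Proof.
move=> uM cM.
have scal (x : 'rV_m) : x *m c *m u = (x *m c) 0 0 *: u.
  by rewrite {1}[x *m c]mx11_scalar mul_scalar_mx.
have ker_sub (x : 'rV_m) : x *m (M + c *m u) = 0 -> x *m c = 0 /\ x *m M = 0.
  rewrite mulmxDr mulmxA scal => h.
  have [xc0 | xc0] := eqVneq ((x *m c) 0 0) 0.
    by move: h; rewrite xc0 scale0r addr0 => ->; split=> //; apply/matrixP=> i j;
       rewrite !ord1 xc0 mxE.
  case/negP: uM; apply/submxP; exists (- ((x *m c) 0 0)^-1 *: x).
  move/eqP: h; rewrite addr_eq0 -scalemxAl => /eqP ->.
  by rewrite scalerN scaleNr opprK scalerA mulVf // scale1r.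
suff lt : (kermx (M + c *m u) < kermx M)%MS.
  move/rank_ltmx: lt; rewrite !mxrank_ker.
  by have := rank_leq_row M; have := rank_leq_row (M + c *m u); lia.
rewrite ltmxE; apply/andP; split.
  apply/rV_subP=> x /sub_kermxP h; apply/sub_kermxP.
  by have [] := ker_sub _ h.
apply: contra cM => le; rewrite submxE; apply/eqP/trmx_inj.
rewrite trmx_mul trmxK trmx0; apply/row_matrixP=> i; rewrite row_mul row0.
have [] // := ker_sub (row i (cokermx M^T)^T).
apply/sub_kermxP/(submx_trans _ le)/sub_kermxP; rewrite -row_mul.
by rewrite -[M in _ *m M]trmxK -trmx_mul mulmx_coker trmx0 row0.
Qed.

(** Choose [U], [V] with [U M V = 1] of size [\rank M]. The polynomial is the minor
    [det (U (M + t E) V)], whose value at [t = 0] is 1. *)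
Lemma mxrank_generic (F : fieldType) m n (M E : 'M[F]_(m, n)) :
  exists2 p : {poly F}, p != 0 &
    forall t, p.[t] != 0 -> (\rank M <= \rank (M + t *: E)%R)%N.
Proof.
have /row_fullP [U UM] := col_base_full M.
have /row_freeP [V MV] := row_base_free M.
pose p := \det (1%:M + 'X *: map_mx polyC (U *m E *m V)).
have pE t : p.[t] = \det (1%:M + t *: (U *m E *m V)).
  rewrite -[LHS]/(horner_eval t p) -det_map_mx; congr (\det _).
  apply/matrixP=> i j; rewrite !mxE rmorphD rmorphM rmorph_nat.
  by rewrite /= /horner_eval hornerX hornerC.
exists p => [|t].
  apply: contra_neq (oner_neq0 F) => p0.
  rewrite -(det1 F (\rank M)) -[1%:M]addr0 -(scale0r (U *m E *m V)) -pE p0.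
  by rewrite horner0.
rewrite pE -unitfE -[_ \in _]/(_ \in unitmx) => /mxrank_unit <-.
have -> : 1%:M + t *: (U *m E *m V) = U *m (M + t *: E) *m V.
  rewrite mulmxDr mulmxDl -scalemxAr -scalemxAl; congr (_ + _).
  transitivity (U *m (col_base M *m row_base M) *m V).
    by rewrite mulmxA UM mul1mx MV.
  by rewrite mulmx_base.
by apply: leq_trans (mxrankM_maxl _ _) (mxrankM_maxr _ _).
Qed.

Lemma poly_int_nonroot (p : {poly rat}) :
  p != 0 -> exists2 t : int, t != 0 & p.[t%:~R] != 0.
Proof.
move=> p0; pose s := [seq i%:R : rat | i <- iota 1 (size p)].
have us : uniq s.
  by rewrite map_inj_uniq ?iota_uniq // => i j /eqP; rewrite eqr_nat => /eqP.
have : ~~ all (root p) s.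
  by apply/negP=> /(max_poly_roots p0)/(_ us); rewrite size_map size_iota ltnn.
case/allPn=> _ /mapP [i + ->] nr; rewrite mem_iota => /andP [i0 _].
by exists i%:Z; [rewrite -lt0n | rewrite -pmulrn].
Qed.

(** Two proper subspaces do not cover the space: one of [u1], [u2], [u1 + u2] avoids both. *)
Lemma avoid_submx N n1 n2 m1 m2 (B1 : 'M[rat]_(N, n1)) (B2 : 'M[rat]_(N, n2))
    (M1 : 'M_(m1, n1)) (M2 : 'M_(m2, n2)) :
  ~~ (B1 <= M1)%MS -> ~~ (B2 <= M2)%MS ->
  exists2 u : 'rV[int]_N, ~~ (map_mx intr u *m B1 <= M1)%MS &
    ~~ (map_mx intr u *m B2 <= M2)%MS.
Proof.
have ex n m (B : 'M[rat]_(N, n)) (M : 'M_(m, n)) : ~~ (B <= M)%MS ->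
    exists u : 'rV[int]_N, ~~ (map_mx intr u *m B <= M)%MS.
  by case/row_subPn=> i h; exists (delta_mx 0 i); rewrite map_delta_mx -rowE.
move=> /ex [u1 h1] /ex [u2 h2].
have [g1 | ] := boolP (map_mx intr u1 *m B2 <= M2)%MS; last by exists u1.
have [g2 | ] := boolP (map_mx intr u2 *m B1 <= M1)%MS; last by exists u2.
exists (u1 + u2); rewrite map_mxD mulmxDl.
  by apply: contra h1 => h; rewrite -[X in (X <= _)%MS](addrK (map_mx intr u2 *m B1))
    addmx_sub ?eqmx_opp.
by apply: contra h2 => h; rewrite -[X in (X <= _)%MS](addKr (map_mx intr u1 *m B2))
  addmx_sub ?eqmx_opp.
Qed.

Section GenericLift.
Variables (q n r : nat) (q_prime : prime q).

Local Notation ratmx := (map_mx (intr : int -> rat)).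
Local Notation red := (map_mx (intr : int -> 'F_q)).

Definition visible_rank (L : 'M[int]_(r, n + n)) A :=
  \rank (ratmx L *m restrmx rat A).

(** The terms linear in [t] are [c c^T] and its negative, and the quadratic term vanishes because
    the form is alternating. *)
Lemma transvect_isotropic (L : 'M[int]_(r, n + n)) (u : 'rV_(n + n)) (t : int) :
  isotropic L -> isotropic (L + t *: (L *m sympmx *m u^T *m u)).
Proof.
move=> /isotropicP Liso; apply/isotropicP; set c := L *m sympmx *m u^T.
have uL : u *m sympmx *m L^T = - c^T by rewrite /c tr_symp_form opprK.
have h1 : L *m sympmx *m (c *m u)^T = c *m c^T by rewrite trmx_mul mulmxA.
clearbody c; have h2 : c *m u *m sympmx *m L^T = - (c *m c^T).
  by rewrite -!mulmxA (mulmxA u) uL mulmxN.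
have h3 : c *m u *m sympmx *m (c *m u)^T = 0.
  by rewrite trmx_mul !mulmxA -2!(mulmxA c) symp_alt mulmx0 mul0mx.
rewrite linearD /= linearZ /= !(mulmxDl, mulmxDr) -!scalemxAl -!scalemxAr.
by rewrite Liso h1 h2 h3 !scaler0 addr0 add0r scalerN addNr.
Qed.

(* The transvection along [u] adds the rank one matrix [(L J u^T) u]; away from
   finitely many scalars it lowers no visible rank, and [u] is chosen so that it
   raises the one at [A]. *)
Lemma visible_rank_improve (L : 'M[int]_(r, n + n)) (A : {set 'I_n}) :
  row_free (red L) -> isotropic L -> (#|A|.*2 <= r)%N ->
  visible_rank L A != \rank (restrmx rat A) ->
  exists L', [/\ red L' = red L, isotropic L' &
    (\sum_B visible_rank L B < \sum_B visible_rank L' B)%N].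
Proof.
move=> Lfree Liso Ar nA; set M := ratmx L *m restrmx rat A.
have lt : (\rank M < \rank (restrmx rat A))%N.
  by rewrite ltn_neqAle nA mxrankM_maxr.
(* These are the two conditions of [mxrank_add_rank1] at [A]. The second can be met because [L J]
   has rank [r], and [r >= 2|A| > \rank M]. *)
have [||u u1 u2] := @avoid_submx (n + n) _ _ _ _ (restrmx rat A)
    (ratmx L *m sympmx)^T M M^T.
- by apply: contraL lt => /mxrankS; rewrite -leqNgt.
- apply: contraL lt => /mxrankS.
  rewrite !mxrank_tr mxrankMfree ?row_free_unit ?sympmx_unit //.
  have /eqP -> := row_free_rat Lfree.
  by rewrite -leqNgt; apply: leq_trans; apply: leq_trans (mxrank_restrmx _ _) Ar.
pose c := L *m sympmx *m u^T.
pose E B := q%:R *: (ratmx c *m (ratmx u *m restrmx rat B)).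
(* The factor [q] keeps the reduction modulo [q] unchanged. *)
pose L' (t : int) := L + (q%:Z * t) *: (c *m u).
have L'E t B : ratmx (L' t) *m restrmx rat B =
    ratmx L *m restrmx rat B + t%:~R *: E B.
  rewrite /L' /E map_mxD map_mxZ map_mxM mulmxDl -scalemxAl mulmxA scalerA.
  by rewrite /= intrM mulrC.
have [p p0 pB] : exists2 p : {poly rat}, p != 0 & forall t : int, p.[t%:~R] != 0 ->
    forall B, (visible_rank L B <= visible_rank (L' t) B)%N.
  have /fin_all_exists2 [p p0 pB] B :=
    mxrank_generic (ratmx L *m restrmx rat B) (E B).
  exists (\prod_B p B) => [|t]; first by apply/prodf_neq0=> B _.
  rewrite horner_prod => /prodf_neq0 h B; rewrite /visible_rank L'E.
  by apply: pB; apply: h.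
have [t t0 pt] := poly_int_nonroot p0.
exists (L' t); split.
- rewrite /L' map_mxD -scalerA redZ_qmul //; exact: addr0.
- exact: transvect_isotropic.
rewrite (bigD1 A) //= [X in (_ < X)%N](bigD1 A) //= -addSn leq_add //; last first.
  by apply: leq_sum => B _; apply: pB.
rewrite /visible_rank L'E /E scalerA scalemxAl.
have qt0 : t%:~R * q%:R != 0 :> rat.
  by rewrite mulf_neq0 ?intr_eq0 // pnatr_eq0 -lt0n prime_gt0.
apply: mxrank_add_rank1 => //.
have -> : (t%:~R * q%:R *: ratmx c)^T =
    (t%:~R * q%:R) *: (ratmx u *m (ratmx L *m sympmx)^T).
  by rewrite linearZ /= !map_mxM map_sympmx -map_trmx trmx_mul trmxK.
by rewrite (eqmx_scale _ qt0).
Qed.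

(** Iterating [visible_rank_improve] terminates: the sum of all visible ranks grows strictly, and
    each is at most [r]. *)
Lemma generic_isotropic_lift (G : 'M['F_q]_(r, n + n)) :
  row_free G -> isotropic G ->
  exists L, LDI_form G L /\
    forall A : {set 'I_n}, (#|A|.*2 <= r)%N ->
      visible_rank L A = \rank (restrmx rat A).
Proof.
move=> Gfree Giso.
have [L LG] := isotropic_lift q_prime Gfree Giso.
pose bound := (#|{set 'I_n}| * r)%N.
have le L1 : (\sum_B visible_rank L1 B <= bound)%N.
  by rewrite /bound -sum_nat_const; apply: leq_sum => B _; apply: rank_leq_row.
move: {2}(bound - _)%N (leqnn (bound - \sum_B visible_rank L B)) => m.
elim: m L LG => [|m IH] L LG hm.
all: have [/forallP h | /forallPn [A]] := boolP
  [forall A : {set 'I_n},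
     (#|A|.*2 <= r)%N ==> (visible_rank L A == \rank (restrmx rat A))];
  first by [exists L; split=> // A Ar; apply/eqP; apply: (implyP (h A))].
all: rewrite negb_imply => /andP [Ar nA]; case: LG => LG Liso.
all: have Lf : row_free (red L) by rewrite [red L]LG.
all: have [L' [L'L L'iso lt]] := visible_rank_improve Lf Liso Ar nA.
  by have := le L'; lia.
apply: (IH L'); last by have := le L'; lia.
by split=> //; rewrite -LG.
Qed.

(** Full rank on the support [A] of [v] makes every vector on [A] the restriction of a rational
    combination of rows of [L]. Hence [v] commutes with everything on [A], so with everything, and
    nondegeneracy gives [v = 0]. *)
Lemma visible_rank_wt (L : 'M[int]_(r, n + n)) (v : 'rV_(n + n)) :
  (forall A : {set 'I_n}, (#|A|.*2 <= r)%N ->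
      visible_rank L A = \rank (restrmx rat A)) ->
  L *m sympmx *m v^T = 0 -> ((wt v).*2 <= r)%N -> v = 0.
Proof.
move=> full Lv wv; set A := supp v.
have /submxP [Y YL] : (restrmx rat A <= ratmx L *m restrmx rat A)%MS.
  have le : (ratmx L *m restrmx rat A <= restrmx rat A)%MS by apply: submxMl.
  move/leqifP: (mxrank_leqif_sup le); rewrite -(full _ wv).
  by case: ifP => // _; rewrite ltnn.
have vA : restrmx rat A *m (ratmx v)^T = (ratmx v)^T.
  rewrite -[X in X *m _]tr_restrmx -trmx_mul -(map_restrmx intr) -map_mxM.
  by rewrite restrmx_supp.
have Jv : sympmx *m (ratmx v)^T = 0.
  rewrite -vA mulmxA -restrmx_symp YL -!mulmxA (mulmxA _ sympmx) restrmx_symp.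
  rewrite -(mulmxA sympmx) vA -(map_sympmx intr) map_trmx -!map_mxM mulmxA Lv.
  by rewrite map_mx0 mulmx0.
have v0 : (ratmx v)^T = 0.
  rewrite -[LHS]mul1mx -[1%:M]opprK -sympmx_sqr mulNmx -mulmxA Jv.
  by rewrite mulmx0 oppr0.
apply/rowP=> j; move/matrixP/(_ j 0): v0; rewrite !mxE => /eqP.
by rewrite intr_eq0 => /eqP.
Qed.
End GenericLift.

(** * The quantum Singleton bound *)

Lemma card_ord_range n a b : (#|[set i : 'I_n | a <= i < b]| <= b - a)%N.
Proof.
rewrite cardE -(size_map val) -(size_iota a (b - a)); apply: uniq_leq_size.
  by rewrite (map_inj_uniq val_inj) enum_uniq.
move=> _ /mapP [i + ->]; rewrite mem_enum inE mem_iota => /andP [ai ib].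
by rewrite ai /= subnKC // (leq_trans ai) // ltnW.
Qed.

(* Errors on [A] (the first [a] registers) and on
   [B] (the last [a], minus [A]) are correctable, so a vector commuting with [G]
   and supported off [A] is determined, up to stabilizers, by its restriction to
   the remaining set [C]. *)
Lemma quantum_singleton (F : fieldType) n r (G : 'M[F]_(r, n + n)) (a : nat) :
  row_free G ->
  (forall v, G *m sympmx *m v^T = 0 -> (wt v <= a)%N -> (v <= G)%MS) ->
  (r < n)%N -> (a.*2 <= r)%N.
Proof.
move=> /eqP Gr correct rn.
pose A := [set i : 'I_n | (0 <= i < a)%N].
pose C := [set i : 'I_n | (a <= i < n - a)%N].
pose K := sympmx *m G^T.
(* [W X] is the space of vectors supported on [X] that commute with [G]. *)
pose W X := (restrmx F X :&: kermx K)%MS.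
have W_rank X : (\rank (G *m restrmx F X) + \rank (W X))%N = \rank (restrmx F X).
  have XK : restrmx F X *m K = - (G *m restrmx F X *m sympmx)^T.
    rewrite /K !trmx_mul tr_restrmx tr_sympmx mulNmx opprK !mulmxA.
    by rewrite restrmx_symp.
  rewrite -[RHS](mxrank_mul_ker _ K) XK mxrank_opp mxrank_tr.
  by rewrite [in RHS]mxrankMfree ?row_free_unit ?sympmx_unit.
have G_rank X := mxrank_mul_ker G (restrmx F X).
have W_sub X (v : 'rV_(n + n)) : (v <= W X)%MS ->
    v *m restrmx F (~: X) = 0 /\ G *m sympmx *m v^T = 0.
  rewrite sub_capmx => /andP [/submxP [y ->] /sub_kermxP h]; split.
    have -> : restrmx F (~: X) = 1%:M - restrmx F X.
      by rewrite -(restrmxC F X) addrC addKr.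
    by rewrite mulmxBr mulmx1 restrmx_id subrr.
  by apply: trmx_inj; rewrite tr_symp_form trmx0 -mulmxA h oppr0.
have sub1 : (W A <= G :&: kermx (restrmx F (~: A)))%MS.
  apply/rV_subP=> v /W_sub [vA Gv]; rewrite sub_capmx; apply/andP; split.
    apply: correct => //; rewrite -[a]subn0; apply: leq_trans (card_ord_range _ _ _).
    by move/subset_leq_card: (restrmx_eq0 vA); rewrite setCK; apply.
  exact/sub_kermxP.
have sub2 : (W (~: A) :&: kermx (restrmx F C) <= G :&: kermx (restrmx F A))%MS.
  apply/rV_subP=> v; rewrite sub_capmx => /andP [/W_sub [vA Gv] /sub_kermxP vC].
  rewrite setCK in vA; rewrite sub_capmx; apply/andP; split; last exact/sub_kermxP.
  apply: correct => //; apply: leq_trans (_ : n - (n - a) <= a)%N; last by lia.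
  apply: leq_trans (card_ord_range n (n - a) n); apply: subset_leq_card.
  apply/subsetP=> i iv.
  have := subsetP (restrmx_eq0 vA) _ iv; have := subsetP (restrmx_eq0 vC) _ iv.
  by rewrite !inE ltn_ord; lia.
(* In the sum of all these relations the ranks of [G] restricted to [A] and to [~: A] cancel,
   leaving [2n <= 2r + 2|C|]. As [r < n], [C] is nonempty, so the truncated [n - a - a] is a true
   difference and [2a <= r]. *)
have := mxrank_mul_ker (W (~: A)) (restrmx F C).
have := mxrankM_maxr (W (~: A)) (restrmx F C).
have := mxrankS sub1; have := mxrankS sub2.
have := W_rank A; have := W_rank (~: A); have := G_rank A; have := G_rank (~: A).
have : (n + n <= \rank (restrmx F A) + \rank (restrmx F (~: A)))%N.
  by rewrite -[X in (X <= _)%N](mxrank1 F) -(restrmxC F A) mxrank_add.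
have := mxrank_restrmx F C; have : (#|C| <= n - a - a)%N by apply: card_ord_range.
rewrite Gr; clear -rn; move: #|C|; do ![move: (\rank _) => ?]; lia.
Qed.

Lemma symp_row_spaceP (F : fieldType) n m (G : 'M[F]_(m, n + n)) (v : 'rV_(n + n)) :
  (forall s : 'rV_(n + n), (s <= G)%MS -> symp s v = 0) <-> G *m sympmx *m v^T = 0.
Proof.
rewrite -symp_rowsP; split=> [h i | /symp_rowsP h _ /submxP [c ->]].
  by apply: h; apply: row_sub.
by rewrite symp_mx -!mulmxA (mulmxA G) h mulmx0 mxE.
Qed.

(** If [n <= r], the commutant of [G] has rank [2n - r <= r], so it equals the row space of [G] and
    contains [v]. *)
Lemma undetected_rank_lt (F : fieldType) n r (G : 'M[F]_(r, n + n))
    (v : 'rV_(n + n)) :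
  row_free G -> isotropic G -> G *m sympmx *m v^T = 0 -> ~~ (v <= G)%MS -> (r < n)%N.
Proof.
move=> /eqP Gr /isotropicP Giso Gv nvG; rewrite ltnNge; apply: contra nvG => nr.
have Gker : (G <= kermx (sympmx *m G^T))%MS by apply/sub_kermxP; rewrite mulmxA.
have vker : (v <= kermx (sympmx *m G^T))%MS.
  by apply/sub_kermxP/trmx_inj; rewrite mulmxA tr_symp_form Gv oppr0 trmx0.
apply: submx_trans vker _.
have rk : \rank (sympmx *m G^T) = r.
  rewrite -mxrank_tr trmx_mul trmxK tr_sympmx mulmxN mxrank_opp.
  by apply: etrans Gr; apply: mxrankMfree; rewrite row_free_unit sympmx_unit.
have := mxrankS Gker; rewrite -(mxrank_leqif_sup Gker) mxrank_ker rk Gr.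
by move=> ?; apply/eqP; lia.
Qed.

(** [P] is an arbitrary proposition, so the descent on weights uses excluded middle. *)
Lemma min_weight_exists (R : comNzRingType) n (P : 'rV[R]_(n + n) -> Prop) v :
  P v -> exists d, min_weight P d.
Proof.
have [m] := ubnP (wt v); elim: m v => // m IH v vm Pv.
have [[u [Pu uv]] | none] :=
    Classical_Prop.classic (exists u, P u /\ (wt u < wt v)%N).
  by apply: (IH u) => //; apply: leq_trans uv vm.
exists (wt v); split=> [|u Pu]; first by exists v.
by rewrite leqNgt; apply/negP=> uv; case: none; exists u.
Qed.

Lemma logical_Z_unavoidable n m (L : 'M[int]_(m, n + n)) v :
  logical_Z L v <-> unavoidable L v.
Proof.
rewrite /logical_Z /unavoidable; split=> -[Lv nv]; split=> //.
  by move=> i; apply: Lv; exists (delta_mx 0 i); rewrite rowE.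
move/symp_rowsP: Lv => Lv _ [c ->].
by rewrite symp_mx -!mulmxA (mulmxA L) Lv mulmx0 mxE.
Qed.

Theorem theorem7 (q n k d : nat) (G : 'M['F_q]_(n - k, n + n)) :
  prime q -> stab_code_q k d G ->
  exists L : 'M[int]_(n - k, n + n),
    LDI_form G L /\
    exists d' : nat, stab_code_Z L k d' /\ dstar L d' /\ (d <= d')%N.
Proof.
move=> q_prime [_ Giso Gfree [[w [[/symp_row_spaceP Gw nw] _]] dmin]].
have [L [[redL Liso] Lfull]] := generic_isotropic_lift q_prime Gfree Giso.
exists L; split=> //.
have Lfree : row_free (map_mx (intr : int -> 'F_q) L) by rewrite [map_mx _ _]redL.
have redLspan (c : 'rV_(n - k)) : (map_mx (intr : int -> 'F_q) (c *m L) <= G)%MS.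
  by rewrite map_mxM [map_mx _ L]redL submxMl.
(* The lift [v] of [w] is unavoidable: the integer span of [L] reduces into the row space of [G],
   which misses [w]. *)
have [v vw Lv] : exists2 v : 'rV[int]_(n + n),
    map_mx (intr : int -> 'F_q) v = w & L *m sympmx *m v^T = 0.
  have [||v [vw Lv]] := @kernel_lift q _ _ (L *m sympmx) w^T.
  - by rewrite map_mxM map_sympmx /row_free mxrankMfree ?row_free_unit ?sympmx_unit.
  - by rewrite map_mxM map_sympmx [map_mx _ L]redL.
  exists v^T; last by rewrite trmxK.
  by rewrite -map_trmx vw trmxK.
have Uv : unavoidable L v.
  split; first exact/symp_rowsP.
  by case=> c vc; case/negP: nw; rewrite -vw vc.
have [d' dmin'] := min_weight_exists Uv.
exists d'; split; last split=> //.
  split=> //; first by apply/eqP; apply: (row_free_rat Lfree).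
  case: dmin' => -[u [Uu du] h]; split.
    by exists u; split=> //; apply/logical_Z_unavoidable.
  by move=> x /logical_Z_unavoidable; apply: h.
case: dmin' => -[u [[/symp_rowsP Lu nu] <-] _]; rewrite leqNgt; apply/negP=> ud.
(* An unavoidable [u] of weight below [d] would be zero, which lies in the span with coefficients
   0. *)
case: nu; exists 0; rewrite mul0mx; apply: (visible_rank_wt Lfull Lu).
apply: leq_trans (_ : d.-1.*2 <= _)%N; first by rewrite leq_double; lia.
(* Apply the bound with [a = d - 1]: by minimality of [d], undetected errors of weight at most
   [d - 1] are stabilizers. *)
apply: (quantum_singleton Gfree); last first.
  exact: undetected_rank_lt Gfree Giso Gw nw.
move=> x Gx xd; apply/negPn/negP=> nx.
suff : (d <= wt x)%N by lia.
by apply: dmin; split=> //; apply/symp_row_spaceP.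
Qed.
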